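(* $\mathrm{NICF}_5^* \setminus \mathbb{Q} \subseteq C_{\mathrm{NICF}}$.
   Context: NICF expansion: for real $x$, set $x_0=x$, $a_i=\lfloor x_i\rceil$ (nearest integer), $x_{i+1}=1/(x_i-a_i)$ while $x_i\ne a_i$; $x=[a_0;a_1,a_2,\ldots]$. $\mathrm{NICF}_5^*\setminus\mathbb{Q}$ is the set of irrational $x\in[0,1]$ whose NICF expansion satisfies, for all $i\ge1$: $|a_i|\le 5$, and if $|a_i|=5$ then $a_{i+1}$ has sign opposite to $a_i$. Notation: for integers $a_0,\ldots,a_n$ and real $z$, $[a_0;a_1,\ldots,a_n:z]$ denotes $a_0+\cfrac{1}{a_1+\cfrac{1}{\ddots+\cfrac{1}{a_n+\frac1z}}}$ (for $n=0$: $a_0+1/z$). Let $\mu=\frac{5+\sqrt{21}}{2}$. For a finite integer sequence $\bar a=(a_0,\ldots,a_n)$ and integer $k$ put $P_{k^+}(\bar a)=[a_0;a_1,\ldots,a_n,k:\mu]$ and $P_{k^-}(\bar a)=[a_0;a_1,\ldots,a_n,k:-\mu]$, and let $T_{u,v}(\bar a)$ be the closed interval with endpoints $P_{u^+}(\bar a)$ and $P_{v^-}(\bar a)$. Let $T_{0,1}=[1/\mu,\,1-1/\mu]$. The Cantor set $C_{\mathrm{NICF}}$ is constructed from the initial interval $T_{0,1}$ by repeatedly removing an open gap from each interval, the two closed pieces that remain being the next intervals, according to the rules (where $(\bar a,b)$ denotes $\bar a$ with $b$ appended): (1) $T_{0,1}$: gap is the open interval between $[0;2:\mu]$ and $[1;-2:-\mu]$;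 remaining intervals $T_{2,5}((0))$ and $T_{-5,-2}((1))$. (2) $T_{b,b+1}(\bar a)$ with $b\in\{-5,-4,-3,2,3,4\}$: gap between $P_{2^+}((\bar a,b))$ and $P_{-2^-}((\bar a,b+1))$; remaining $T_{2,5}((\bar a,b))$ and $T_{-5,-2}((\bar a,b+1))$. (3) $T_{2,5}(\bar a)$: gap between $P_{3^-}(\bar a)$ and $P_{3^+}(\bar a)$; remaining $T_{2,3}(\bar a)$, $T_{3,5}(\bar a)$. (4) $T_{3,5}(\bar a)$: gap between $P_{4^-}(\bar a)$ and $P_{4^+}(\bar a)$; remaining $T_{3,4}(\bar a)$, $T_{4,5}(\bar a)$. (5) $T_{-5,-2}(\bar a)$: gap between $P_{-3^-}(\bar a)$ and $P_{-3^+}(\bar a)$; remaining $T_{-5,-3}(\bar a)$, $T_{-3,-2}(\bar a)$. (6) $T_{-5,-3}(\bar a)$: gap between $P_{-4^-}(\bar a)$ and $P_{-4^+}(\bar a)$; remaining $T_{-5,-4}(\bar a)$, $T_{-4,-3}(\bar a)$. In each case the gap lies inside the interval and the interval is the disjoint union of the gap and the two remaining intervals. Let $\mathcal{F}$ be the family of intervals obtained from $T_{0,1}$ by iterating these rules; then $C_{\mathrm{NICF}}=T_{0,1}\setminus\bigcup_{I\in\mathcal{F}}(\text{gap of }I)$. *)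

(* Defs.v *)
From HB Require Import structures.
From mathcomp Require Export all_boot all_order all_algebra.
From mathcomp Require Export mathcomp_extra boolp classical_sets set_interval.
From mathcomp Require Export reals.

Set Implicit Arguments.
Unset Strict Implicit.
Unset Printing Implicit Defensive.

Import Order.TTheory GRing.Theory Num.Theory.
Local Open Scope classical_set_scope.
Local Open Scope ring_scope.

Section Expansion.
Context {R : realType}.
Implicit Types x : R.

(* Half-integers are rounded up; this choice never matters for the expansion
   of an irrational number. *)
Definition nearest_int x : int := Num.floor (x + 2^-1).

(* Since 0^-1 = 0, the recursion continues with zeros when the expansion
   stops, i.e. when x_i = a_i; this never happens for x irrational. *)
Fixpoint nicf_rem x (i : nat) : R :=
  if i is i'.+1
  then (nicf_rem x i' - (nearest_int (nicf_rem x i'))%:~R)^-1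
  else x.

Definition nicf_digit x (i : nat) : int := nearest_int (nicf_rem x i).

Definition NICF5star_irrational : set R :=
  [set x | [/\ 0 <= x <= 1, irrational x &
    forall i : nat, (1 <= i)%N ->
      `|nicf_digit x i| <= 5 /\
      (`|nicf_digit x i| = 5 -> nicf_digit x i * nicf_digit x i.+1 < 0)]].

End Expansion.

Section CantorSet.
Context {R : realType}.

(* [a_0; a_1, ..., a_n : z]; the empty sequence gives z. *)
Definition cfrac (a : seq int) (z : R) : R :=
  foldr (fun (b : int) (y : R) => b%:~R + y^-1) z a.

Definition mu : R := (5 + Num.sqrt 21) / 2.

Definition Pplus (k : int) (a : seq int) : R := cfrac (rcons a k) mu.
Definition Pminus (k : int) (a : seq int) : R := cfrac (rcons a k) (- mu).

Definition closed_between (p q : R) : set R :=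
  `[Order.min p q, Order.max p q]%classic.
Definition open_between (p q : R) : set R :=
  `]Order.min p q, Order.max p q[%classic.

(* The rules depend on the data (u, v, a) and not only on the set T_{u,v}(a),
   so the construction is carried out on these triples. The initial T_{0,1}
   is the triple (0, 1, [::]). *)
Record label := Label { lab_u : int; lab_v : int; lab_a : seq int }.

Definition T (I : label) : set R :=
  closed_between (Pplus (lab_u I) (lab_a I)) (Pminus (lab_v I) (lab_a I)).

Definition T01 : label := Label 0 1 [::].

Lemma T01E : T T01 = `[mu^-1, 1 - mu^-1]%classic.
Proof.
have mu2 : 2 <= mu.
  rewrite /mu ler_pdivlMr ?ltr0n // -natrM.
  by rewrite (@le_trans _ _ 5) ?ler_nat // lerDl sqrtr_ge0.
have mu0 : 0 < mu by apply: lt_le_trans mu2; rewrite ltr0n.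
rewrite /T /closed_between /Pplus /Pminus /cfrac /= add0r invrN.
have le : mu^-1 <= 1 - mu^-1.
  have h : mu^-1 <= 2^-1 by rewrite lef_pV2 ?posrE ?ltr0n.
  by rewrite lerBrDr (le_trans (lerD h h)) // -div1r -splitr.
by rewrite (min_idPl le) (max_idPr le).
Qed.

(* [splits I G J K]: G is the gap of I, and J, K are the two remaining
   intervals. *)
Inductive splits : label -> set R -> label -> label -> Prop :=
| splits_01 :
    splits T01
      (open_between (cfrac [:: 0; 2] mu) (cfrac [:: 1; -2] (- mu)))
      (Label 2 5 [:: 0]) (Label (-5) (-2) [:: 1])
| splits_consecutive (a : seq int) (b : int) :
    b \in [:: -5; -4; -3; 2; 3; 4] ->
    splits (Label b (b + 1) a)
      (open_between (Pplus 2 (rcons a b)) (Pminus (-2) (rcons a (b + 1))))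
      (Label 2 5 (rcons a b)) (Label (-5) (-2) (rcons a (b + 1)))
| splits_2_5 (a : seq int) :
    splits (Label 2 5 a) (open_between (Pminus 3 a) (Pplus 3 a))
      (Label 2 3 a) (Label 3 5 a)
| splits_3_5 (a : seq int) :
    splits (Label 3 5 a) (open_between (Pminus 4 a) (Pplus 4 a))
      (Label 3 4 a) (Label 4 5 a)
| splits_m5_m2 (a : seq int) :
    splits (Label (-5) (-2) a) (open_between (Pminus (-3) a) (Pplus (-3) a))
      (Label (-5) (-3) a) (Label (-3) (-2) a)
| splits_m5_m3 (a : seq int) :
    splits (Label (-5) (-3) a) (open_between (Pminus (-4) a) (Pplus (-4) a))
      (Label (-5) (-4) a) (Label (-4) (-3) a).

Inductive family : label -> Prop :=
| family_init : family T01
| family_left I G J K : family I -> splits I G J K -> family J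
| family_right I G J K : family I -> splits I G J K -> family K.

Definition gaps : set (set R) :=
  [set G | exists I J K, family I /\ splits I G J K].

Definition C_NICF : set R := T T01 `\` \bigcup_(G in gaps) G.

End CantorSet.

(* Main.v *)
Require Import Defs.
From mathcomp Require Import zify lra.
Import Order.TTheory GRing.Theory Num.Theory.
Local Open Scope classical_set_scope.
Local Open Scope ring_scope.

(* Every complete quotient x_i with i >= 1 satisfies |x_i| <= mu: since
   mu = 5 - 1/mu, an excess |x_i| - mu > 0 forces a_i = +-5 and a digit a_{i+1}
   of the opposite sign, and the excess is at least doubled at x_{i+1}, which
   cannot go on because |x_i| < 6.  In the coordinate y of x = [a : y], an
   interval T_{u,v}(a) is u + 1/mu <= y <= v - 1/mu, and y is there the complete
   quotient of x following the digits a.  In this coordinate, a gap consists of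
   points within distance < 1/mu of an integer, or of points whose next complete
   quotient is within distance < 1/mu of +-2; either would give a complete
   quotient of modulus > mu. *)

(** * Preliminaries on digits, irrational complete quotients and [mu] *)

Section NearestInt.
Context {R : realType}.
Implicit Types (x y : R) (k : int).

Lemma nearest_int_itv x :
  (nearest_int x)%:~R - 2^-1 <= x < (nearest_int x)%:~R + 2^-1.
Proof.
have := floor_itv (x + 2^-1); rewrite -/(nearest_int x) intrD => /andP[h1 h2].
by apply/andP; split; lra.
Qed.

Lemma nearest_int_eq x k : k%:~R - 2^-1 <= x < k%:~R + 2^-1 ->
  nearest_int x = k.
Proof.
move=> /andP[h1 h2]; apply: floor_def; rewrite intrD.
by apply/andP; split; lra.
Qed.

Lemma nicf_remS x i : nicf_rem x i.+1 =
  (nicf_rem x i - (nicf_digit x i)%:~R)^-1.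
Proof. by []. Qed.

Lemma irrational_neq_int x k : irrational x -> x != k%:~R.
Proof. by move=> xI; apply/eqP => xk; apply: xI; exists k%:~R; rewrite ?ratr_int. Qed.

Lemma nicf_rem_irrational x i : irrational x -> irrational (nicf_rem x i).
Proof.
move=> xI; elim: i => [//|i IH]; rewrite nicf_remS => -[q _ qE]; apply: IH.
exists (q^-1 + (nicf_digit x i)%:~R) => //.
by rewrite rmorphD /= fmorphV /= qE ratr_int invrK subrK.
Qed.


End NearestInt.
Section Mu.
Context {R : realType}.
Local Notation mu := (@mu R).

(** [mu] is the larger root of [t^2 - 5 t + 1], and [mu^-1] is its conjugate. *)
Lemma mu_bounds : [/\ mu = 5 - mu^-1, 5^-1 < mu^-1 & mu^-1 < 4^-1].
Proof.
have s2 : (Num.sqrt 21 : R) ^+ 2 = 21 by rewrite sqr_sqrtr.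
have s0 : 0 <= (Num.sqrt 21 : R) by apply: sqrtr_ge0.
have s4 : 4 < (Num.sqrt 21 : R) by nra.
have s5 : (Num.sqrt 21 : R) < 5 by nra.
have muV : mu^-1 = (5 - Num.sqrt 21) / 2.
  apply: (@mulfI _ mu); first by rewrite /Defs.mu; lra.
  by rewrite mulfV /Defs.mu; [nra | lra].
by rewrite muV /Defs.mu; split; try lra; nra.
Qed.

End Mu.

(** * Bounds on the complete quotients of a point *)

Section CompleteQuotients.
Context {R : realType}.
Local Notation mu := (@mu R).

(** Here [y] and [w] stand for the moduli of successive complete quotients at a digit 5 or -5. Since
    [5 - mu = mu^-1], the excess is multiplied by exactly [mu * w], and both factors exceed 4. *)
Lemma mu_excess_doubles (y w : R) : mu < y -> 0 < w -> w * (5 - y) = 1 ->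
  2 * (y - mu) <= w - mu.
Proof.
move=> ltmu w0 wE; have [muE nu5 nu4] := @mu_bounds R.
have nuE : mu * mu^-1 = 1 by rewrite mulfV //; lra.
have mu4 : 4 < mu by lra.
have wmu : w - mu = mu * (w * (y - mu)).
  have -> : w * (y - mu) = w * mu^-1 - 1.
    by rewrite -wE -mulrBr; congr (_ * _); lra.
  by rewrite mulrBr mulrCA nuE !mulr1.
have e0 : 0 < w * (y - mu) by rewrite mulr_gt0 // subr_gt0.
have w1 : mu < w by rewrite -subr_gt0 wmu mulr_gt0 //; lra.
rewrite wmu; nra.
Qed.

Variable x : R.
Hypothesis xN : NICF5star_irrational x.

Lemma nicf_rem_neq_digit i : nicf_rem x i - (nicf_digit x i)%:~R != 0.
Proof.
case: xN => _ xI _; rewrite subr_eq0.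
exact/irrational_neq_int/nicf_rem_irrational.
Qed.

Lemma nicf_excess_doubles i : (0 < i)%N -> mu < `|nicf_rem x i| ->
  2 * (`|nicf_rem x i| - mu) <= `|nicf_rem x i.+1| - mu.
Proof.
move=> i0 ltmu; have [_ _ /(_ i i0)[le5 opp5]] := xN.
have [muE nu5 nu4] := @mu_bounds R.
have /andP[lo hi] := nearest_int_itv (nicf_rem x i).
have /andP[lo' hi'] := nearest_int_itv (nicf_rem x i.+1).
rewrite -!/(nicf_digit _ _) in lo hi lo' hi'.
have := nicf_rem_neq_digit i; have := nicf_remS x i.
move: lo hi lo' hi' ltmu le5 opp5.
set a := nicf_digit x i; set a' := nicf_digit x i.+1.
set y := nicf_rem x i; set z := nicf_rem x i.+1 => lo hi lo' hi' ltmu le5 opp5.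
move=> zE f0.
have zf : z * (y - a%:~R) = 1 by rewrite zE mulVf.
(* A smaller digit would give [|y| <= 4 + 2^-1 < mu]. *)
have a5 : `|a| = 5.
  apply/eqP; rewrite eq_le le5 /= leNgt; apply/negP => lt5.
  have : `|a| <= 4 by rewrite -ltzD1.
  rewrite -(@ler_int R) intr_norm => le4.
  have := ler_normD (y - a%:~R) a%:~R; rewrite subrK.
  have : `|y - a%:~R| <= 2^-1 by rewrite ler_norml; apply/andP; split; lra.
  lra.
have {opp5} := opp5 a5.
have {a5} [aE|aE] : a = 5 \/ a = -5 by lia.
  (* The digit [a' <= -1] makes [z] negative, so [y] lies below 5 and [- z] is the inverse of
     [5 - y]. *)
  rewrite {}aE in lo hi zf * => aa'; have {aa'} : a' <= -1 by lia.
  rewrite -(@ler_int R) => a'1; have z0 : z < 0 by lra.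
  rewrite (ltr0_norm z0) gtr0_norm in ltmu *; try lra.
  by apply: mu_excess_doubles => //; lra.
rewrite {}aE in lo hi zf * => aa'; have {aa'} : 1 <= a' by lia.
rewrite -(@ler_int R) => a'1; have z0 : 0 < z by lra.
rewrite (gtr0_norm z0) ltr0_norm in ltmu *; try lra.
by apply: mu_excess_doubles => //; lra.
Qed.

Lemma nicf_rem_le_mu i : (0 < i)%N -> `|nicf_rem x i| <= mu.
Proof.
move=> i0; rewrite leNgt; apply/negP => ltmu.
pose e : R := `|nicf_rem x i| - mu; have e0 : 0 < e by rewrite subr_gt0.
have grow n : 2 ^+ n * e <= `|nicf_rem x (i + n)| - mu.
  elim: n => [|n IH]; first by rewrite addn0 expr0 mul1r.
  have ltmu' : mu < `|nicf_rem x (i + n)|.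
    by rewrite -subr_gt0 (lt_le_trans _ IH) // mulr_gt0 ?exprn_gt0.
  have := nicf_excess_doubles _ (ltn_addr _ i0) ltmu'.
  rewrite -addnS exprS -mulrA; lra.
have ub n : `|nicf_rem x (i + n)| < 6.
  have [_ _ /(_ (i + n)%N (ltn_addr _ i0))[le5 _]] := xN.
  have /andP[] := nearest_int_itv (nicf_rem x (i + n)).
  rewrite -/(nicf_digit _ _); move: le5; rewrite ler_norml -!(@ler_int R).
  by move=> /andP[? ?] ? ?; rewrite ltr_norml; apply/andP; split; lra.
have [n en] : exists n : nat, 6 < 2 ^+ n * e.
  (* The Archimedean property gives [n > 6 / e], and [n < 2 ^ n]. *)
  exists (Num.bound (6 / e)); rewrite -ltr_pdivrMr //.
  apply: (@lt_trans _ _ (Num.bound (6 / e))%:R).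
    by apply: archi_boundP; rewrite divr_ge0 // ltW.
  by rewrite -natrX ltr_nat ltn_expl.
have := grow n; have := ub n; have [] := @mu_bounds R; lra.
Qed.

(** Otherwise the digit would be [k], and the next complete quotient would exceed [mu] in modulus.
    Only that next one has to be bounded, so [i = 0] is allowed. *)
Lemma nicf_rem_away_from_int i (k : int) :
  ~~ (k%:~R - mu^-1 < nicf_rem x i < k%:~R + mu^-1).
Proof.
apply/negP => /andP[lo hi]; have [muE nu5 nu4] := @mu_bounds R.
have dk : nicf_digit x i = k.
  by apply: nearest_int_eq; apply/andP; split; lra.
have f0 := nicf_rem_neq_digit i; have := @nicf_rem_le_mu i.+1 isT.
have mu0 : 0 < mu by lra.
rewrite nicf_remS normfV -[leRHS]invrK lef_pV2 ?posrE ?normr_gt0 ?invr_gt0 //.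
by rewrite dk leNgt ltr_norml => /negP; apply; apply/andP; split; lra.
Qed.

(** Split at the midpoint [b + 2^-1]. To its left the digit is [b] and the next complete quotient
    lies strictly between 2 and [2 + mu^-1]; from it on, the digit is [b + 1] and the mirror image
    occurs at -2. *)
Lemma nicf_rem_notin_middle i (b : int) :
  ~~ (b%:~R + (2 + mu^-1)^-1 < nicf_rem x i < (b + 1)%:~R - (2 + mu^-1)^-1).
Proof.
apply/negP => /andP[lo hi]; have [muE nu5 nu4] := @mu_bounds R.
have g0 : 0 < (2 + mu^-1)^-1 by rewrite invr_gt0; lra.
have gE : (2 + mu^-1)^-1 * (2 + mu^-1) = 1 by rewrite mulVf //; lra.
rewrite intrD in hi.
have [lt|ge] := ltP (nicf_rem x i) (b%:~R + 2^-1).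
  have db : nicf_digit x i = b.
    by apply: nearest_int_eq; apply/andP; split; lra.
  have /negP := nicf_rem_away_from_int i.+1 2; apply.
  have zE := nicf_remS x i; rewrite db in zE.
  have f0 : 0 < nicf_rem x i - b%:~R by lra.
  have z0 : 0 < nicf_rem x i.+1 by rewrite zE invr_gt0.
  have zf : nicf_rem x i.+1 * (nicf_rem x i - b%:~R) = 1 by rewrite zE mulVf ?gt_eqF.
  by apply/andP; split; nra.
have db : nicf_digit x i = b + 1.
  by apply: nearest_int_eq; rewrite intrD; apply/andP; split; lra.
have /negP := nicf_rem_away_from_int i.+1 (-2); apply.
have zE := nicf_remS x i; rewrite db intrD in zE.
have f0 : nicf_rem x i - (b%:~R + 1) < 0 by lra.
have z0 : nicf_rem x i.+1 < 0 by rewrite zE invr_lt0.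
have zf : nicf_rem x i.+1 * (nicf_rem x i - (b%:~R + 1)) = 1.
  by rewrite zE mulVf ?lt_eqF.
by apply/andP; split; nra.
Qed.

Lemma nicf_mem_T01 : T T01 x.
Proof.
have [/andP[x0 x1] xI _] := xN; have [muE nu5 nu4] := @mu_bounds R.
rewrite T01E /= in_itv /= !leNgt -!negb_or; apply/negP => /orP[lt|lt].
  have /negP := nicf_rem_away_from_int 0 0; apply => /=.
  by apply/andP; split; lra.
have /negP := nicf_rem_away_from_int 0 1; apply => /=.
by apply/andP; split; lra.
Qed.

End CompleteQuotients.

(** * Intervals and gaps in the coordinate of the complete quotient *)

Section Tracking.
Context {R : realType}.
Local Notation mu := (@mu R).
Implicit Types (a : seq int) (b : int) (l h p q y z : R) (I J K : label).

Lemma cfrac_rcons a b z : cfrac (rcons a b) z = cfrac a (b%:~R + z^-1).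
Proof. exact: foldr_rcons. Qed.

Lemma open_betweenC p q : open_between p q = open_between q p.
Proof. by rewrite /open_between minC maxC. Qed.

Lemma open_between_lt p q z : p < q -> open_between p q z = (p < z < q).
Proof.
by move=> /ltW pq; rewrite /open_between /= in_itv /= (min_idPl pq) (max_idPr pq).
Qed.

Lemma ltrV2_same_sign p q : 0 < p * q -> (p^-1 < q^-1) = (q < p).
Proof.
have [p0|p0|->] := ltgtP p 0; last by rewrite mul0r ltxx.
  by rewrite nmulr_rgt0 // => q0; rewrite ltf_nV2 ?negrE.
by rewrite pmulr_rgt0 // => q0; rewrite ltf_pV2 ?posrE.
Qed.

(* On [l, h] the map [cfrac a] is inverse to taking the complete quotient
   that follows the digits [a], and it has the intermediate value property. *)
Record tracks l h a : Prop := Tracks {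
  nicf_rem_cfrac y : l <= y <= h -> nicf_rem (cfrac a y) (size a) = y;
  cfrac_ivt p q z : l <= p -> p < q -> q <= h ->
    open_between (cfrac a p) (cfrac a q) z -> exists2 y, p < y < q & z = cfrac a y
}.

Lemma tracks_nil l h : tracks l h [::].
Proof. by split=> // p q z _ pq _; rewrite open_between_lt //; exists z. Qed.

Lemma tracks_sub l h l' h' a : l <= l' -> h' <= h -> tracks l h a -> tracks l' h' a.
Proof.
move=> ll' hh' [rem ivt]; split=> [y /andP[ly yh]|p q z lp pq qh].
  by apply: rem; rewrite (le_trans ll' ly) (le_trans yh hh').
by apply: ivt => //; [exact: le_trans lp | exact: le_trans hh'].
Qed.

(** Appending [b] precomposes with [y |-> b + y^-1]. The bounds on [y^-1] make [b] the nearest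
    integer, and [0 < l' * h'] keeps 0 out of the range, so that inversion is decreasing there. *)
Lemma tracks_rcons l h l' h' a b : tracks l h a ->
    (forall y, l' <= y <= h' -> - 2^-1 <= y^-1 < 2^-1 /\ l <= b%:~R + y^-1 <= h) ->
    0 < l' * h' ->
  tracks l' h' (rcons a b).
Proof.
move=> [rem ivt] img sgn.
have sgn2 p q : l' <= p -> p < q -> q <= h' -> 0 < p * q.
  move=> lp pq qh; move: sgn; have [l0|l0|->] := ltgtP l' 0.
  - by rewrite nmulr_rgt0 // => h0; rewrite nmulr_rgt0; lra.
  - by rewrite pmulr_rgt0 // => h0; rewrite pmulr_rgt0; lra.
  - by rewrite mul0r ltxx.
split=> [y yI|p q z lp pq qh].
  have [/andP[y1 y2] yI'] := img y yI.
  rewrite cfrac_rcons size_rcons /= rem // (@nearest_int_eq _ _ b).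
    by rewrite addrC addKr invrK.
  by apply/andP; split; lra.
have pq0 := sgn2 p q lp pq qh.
have qp : q^-1 < p^-1 by rewrite ltrV2_same_sign // mulrC.
have /img[_ /andP[p1 p2]] : l' <= p <= h' by rewrite lp (le_trans (ltW pq)).
have /img[_ /andP[q1 q2]] : l' <= q <= h' by rewrite qh (le_trans _ (ltW pq)).
rewrite !cfrac_rcons open_betweenC => /ivt[| |//|y /andP[qy yp] ->] //.
  by rewrite ltrD2l.
exists (y - b%:~R)^-1; last by rewrite cfrac_rcons invrK addrC subrK.
have {}qy : q^-1 < y - b%:~R by rewrite ltrBrDl.
have {}yp : y - b%:~R < p^-1 by rewrite ltrBlDl.
(* [y - b] lies between two numbers of equal sign, so it can be inverted against each. *)
have [pt tq] : 0 < p^-1 * (y - b%:~R) /\ 0 < (y - b%:~R) * q^-1.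
  have pqV : 0 < p^-1 * q^-1 by rewrite -invfM invr_gt0.
  have [q0|q0] := ltP 0 q^-1; first by split; apply: mulr_gt0; lra.
  have p0 : p^-1 < 0 by nra.
  by split; rewrite nmulr_rgt0; nra.
by apply/andP; split; [rewrite -[p]invrK | rewrite -[q]invrK];
  rewrite ltrV2_same_sign.
Qed.

Definition label_tracks I :=
  tracks ((lab_u I)%:~R + mu^-1) ((lab_v I)%:~R - mu^-1) (lab_a I).

(** As [5 - mu^-1 = mu], inversion sends the range of the label 2, 5 into [mu^-1 <= t < 2^-1], which
    after adding [b] stays in the parent range. The other child is its reflection. *)
Lemma tracks_consecutive a b : label_tracks (Label b (b + 1) a) ->
  label_tracks (Label 2 5 (rcons a b)) /\
  label_tracks (Label (-5) (-2) (rcons a (b + 1))).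
Proof.
have [muE nu5 nu4] := @mu_bounds R.
have inv_pos y : 2 + mu^-1 <= y <= 5 - mu^-1 -> mu^-1 <= y^-1 < 2^-1.
  move=> /andP[y1 y2]; rewrite lef_pV2 ?ltf_pV2 ?posrE; lra.
rewrite /label_tracks /= intrD => tr; split; apply: (tracks_rcons _ _ _ _ _ _ tr); try nra.
  by move=> y /inv_pos/andP[? ?]; split; apply/andP; split; lra.
move=> y /andP[y1 y2]; have /inv_pos : 2 + mu^-1 <= - y <= 5 - mu^-1.
  by apply/andP; split; lra.
rewrite invrN intrD => /andP[? ?]; split; apply/andP; split; lra.
Qed.

Lemma splits_tracks I G J K : @splits R I G J K -> label_tracks I ->
  label_tracks J /\ label_tracks K.
Proof.
have [muE nu5 nu4] := @mu_bounds R.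
case=> [|a b _|a|a|a|a].
(* The initial rule is the consecutive rule with [b = 0] and no digits. *)
- exact: (tracks_consecutive [::] 0).
- exact: tracks_consecutive.
(* The remaining rules keep [a] and only shrink the range. *)
all: by move=> tr; split; apply: tracks_sub tr => /=; lra.
Qed.

Lemma family_tracks I : @family R I -> label_tracks I.
Proof.
elim=> [|{}I G J K _ IH sp|{}I G J K _ IH sp]; first exact: tracks_nil.
  exact: (splits_tracks _ _ _ _ sp IH).1.
exact: (splits_tracks _ _ _ _ sp IH).2.
Qed.

Lemma tracks_rem_between l h a p q (x : R) : tracks l h a ->
    l <= p -> p < q -> q <= h -> open_between (cfrac a p) (cfrac a q) x ->
  p < nicf_rem x (size a) < q.
Proof.
move=> tr lp pq qh /(cfrac_ivt _ _ _ tr _ _ _ lp pq qh)[y /andP[py yq] ->].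
rewrite (nicf_rem_cfrac _ _ _ tr) ?py ?yq //.
by rewrite (le_trans lp (ltW py)) (le_trans (ltW yq) qh).
Qed.

Lemma middle_gap_avoids a b (x : R) : NICF5star_irrational x ->
    label_tracks (Label b (b + 1) a) ->
  ~ open_between (Pplus 2 (rcons a b)) (Pminus (-2) (rcons a (b + 1))) x.
Proof.
move=> xN tr; have [muE nu5 nu4] := @mu_bounds R.
have g1 : (2 + mu^-1)^-1 < 2^-1 by rewrite ltf_pV2 ?posrE; lra.
have g2 : mu^-1 <= (2 + mu^-1)^-1 by rewrite lef_pV2 ?posrE; lra.
(* The endpoints become [cfrac a] at [b + (2 + mu^-1)^-1] and [b + 1 - (2 + mu^-1)^-1]. *)
rewrite /Pplus /Pminus !cfrac_rcons invrN mulrNz -opprD invrN.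
move=> /(tracks_rem_between _ _ _ _ _ _ tr) /=; rewrite !intrD => mid.
have /negP := nicf_rem_notin_middle x xN (size a) b; apply.
by rewrite intrD; apply: mid; lra.
Qed.

(** The gap has endpoints [cfrac a (k - mu^-1)] and [cfrac a (k + mu^-1)]; since
    [u + 1 <= k <= v - 1] and [mu^-1 < 4^-1], both arguments are in range. *)
Lemma int_gap_avoids a (u v k : int) (x : R) : NICF5star_irrational x ->
    label_tracks (Label u v a) -> (u < k < v)%R ->
  ~ open_between (Pminus k a) (Pplus k a) x.
Proof.
move=> xN tr; have [muE nu5 nu4] := @mu_bounds R.
rewrite -!lezD1 -!(@ler_int R) !intrD => /andP[uk kv].
rewrite /Pplus /Pminus !cfrac_rcons invrN.
move=> /(tracks_rem_between _ _ _ _ _ _ tr) /= near.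
have /negP := nicf_rem_away_from_int x xN (size a) k; apply.
by apply: near; lra.
Qed.

Lemma gap_avoids I G J K (x : R) : NICF5star_irrational x ->
  splits I G J K -> label_tracks I -> ~ G x.
Proof.
move=> xN; case=> [|a b _|a|a|a|a] tr.
- exact: (middle_gap_avoids [::] 0 x xN tr).
- exact: middle_gap_avoids.
all: by apply: int_gap_avoids tr _.
Qed.

End Tracking.

Theorem theorem5p2 (R : realType) :
  @NICF5star_irrational R `<=` @C_NICF R.
Proof.
move=> x xN; split; first exact: nicf_mem_T01.
case=> G [I [J [K [famI sp]]]].
exact: gap_avoids xN sp (family_tracks _ famI).
Qed.
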